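(* For every integer $n \geq 1$, $size^{\rm ndc}({\rm Parity}_n) = 3(n-1)$.
   Context: A circuit is a directed acyclic graph whose in-degree-0 nodes (inputs) are each labeled by a variable or a constant $0$ or $1$, whose other nodes (gates) are each labeled by a Boolean function, with one designated output node. $B_2$ is the set of all Boolean functions $\{0,1\}^2\to\{0,1\}$, and $U_2 = B_2 \setminus \{\oplus, \equiv\}$ (all two-variable Boolean functions except XOR and its complement); equivalently, $U_2$ consists of the functions $f(x,y) = ((x\oplus a)\wedge(y\oplus b))\oplus c$ with $a,b,c\in\{0,1\}$. A $U_2$-circuit is a circuit in which every gate has fan-in $2$ and is labeled by a function in $U_2$. A nondeterministic circuit has actual inputs $x=(x_1,\dots,x_n)$ and additional guess inputs $y=(y_1,\dots,y_m)$ (any $m\ge 0$); it computes $f:\{0,1\}^n\to\{0,1\}$ where $f(x)=1$ iff there exists $y\in\{0,1\}^m$ making the circuit output $1$. The size of a circuit is its number of gates. $size^{\rm ndc}(f)$ denotes the minimum size of a nondeterministic $U_2$-circuit computing $f$. ${\rm Parity}_n(x_1,\dots,x_n)=1$ iff $\sum_i x_i \equiv 1 \pmod 2$. *)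

(* Defs.v *)
From mathcomp Require Import all_boot.
Set Implicit Arguments. Unset Strict Implicit. Unset Printing Implicit Defensive.

(* A wire (predecessor of a gate / the output node):
   an input node labelled by an actual variable x_i, a guess variable y_j,
   a constant, or the k-th gate (gates are listed in topological order). *)
Inductive wire : Type :=
  | WVar   of nat
  | WGuess of nat
  | WConst of bool
  | WGate  of nat.

Definition in_U2 (g : bool -> bool -> bool) : Prop :=
  ~ (forall a b, g a b = xorb a b) /\ ~ (forall a b, g a b = ~~ xorb a b).

Record gate : Type := Gate { gfun : bool -> bool -> bool; gleft : wire; gright : wire }.

Record circuit : Type := Circuit { gates : seq gate; out : wire }.

Definition wire_ok (n m k : nat) (w : wire) : bool :=
  match w with
  | WVar i => i < n
  | WGuess j => j < m
  | WConst _ => true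
  | WGate k' => k' < k
  end.

Definition U2_circuit (n m : nat) (C : circuit) : Prop :=
  (forall k, k < size (gates C) ->
     let g := nth (Gate (fun _ _ => false) (WConst false) (WConst false)) (gates C) k in
     in_U2 (gfun g) /\ wire_ok n m k (gleft g) /\ wire_ok n m k (gright g))
  /\ wire_ok n m (size (gates C)) (out C).

Definition csize (C : circuit) : nat := size (gates C).

Definition eval_wire (x y : nat -> bool) (vals : seq bool) (w : wire) : bool :=
  match w with
  | WVar i => x i
  | WGuess j => y j
  | WConst b => b
  | WGate k => nth false vals k
  end.

Definition eval_gates (x y : nat -> bool) (gs : seq gate) : seq bool :=
  foldl (fun vals g => rcons vals (gfun g (eval_wire x y vals (gleft g))
                                          (eval_wire x y vals (gright g)))) [::] gs.

Definition eval_circuit (x y : nat -> bool) (C : circuit) : bool :=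
  eval_wire x y (eval_gates x y (gates C)) (out C).

(* C (with m guess inputs) nondeterministically computes f : {0,1}^n -> {0,1};
   inputs are given as x : nat -> bool, of which only x 0 .. x (n-1) matter. *)
Definition ndc_computes (n m : nat) (C : circuit) (f : (nat -> bool) -> bool) : Prop :=
  forall x : nat -> bool, f x = true <-> exists y : nat -> bool, eval_circuit x y C = true.

Definition has_ndc_of_size (n : nat) (f : (nat -> bool) -> bool) (s : nat) : Prop :=
  exists (m : nat) (C : circuit), U2_circuit n m C /\ csize C = s /\ ndc_computes n m C f.

Definition size_ndc_eq (n : nat) (f : (nat -> bool) -> bool) (s : nat) : Prop :=
  has_ndc_of_size n f s /\ forall s', has_ndc_of_size n f s' -> s <= s'.

Definition parity (n : nat) (x : nat -> bool) : bool := odd (\sum_(i < n) x i).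

(* Main.v *)
Require Import Defs.
From HB Require Import structures.
From mathcomp Require Import all_boot.
From mathcomp Require Import zify.
Set Implicit Arguments. Unset Strict Implicit. Unset Printing Implicit Defensive.

(* Lower bound, by induction on the size. Fix a variable x that still matters.
   If x enters two gates, fix it so that the later one, g, becomes constant: both
   readers and some reader of g disappear, which is three gates. Otherwise x enters
   a single gate g = g(x, H). An accepting computation is sensitive to x, so H must
   have the value h that does not block x. A forced guess H can be replaced by h.
   A forced gate H with two readers can be replaced by h in its readers, which saves
   two gates, at the price of one new output gate testing H = h. Finally, if g is
   the only reader of H, fix x so that g becomes constant: g, H and a reader of g
   disappear. *)

(** * Two-variable functions *)

Lemma in_U2_swap g : in_U2 g -> in_U2 (fun a b => g b a).
Proof.
by move=> [gX gE]; split=> H; [apply: gX | apply: gE] => a b;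
  rewrite H; case: a; case: b.
Qed.

(** Lets a gate absorb negations of its arguments when a negated predecessor is bypassed. *)
Lemma in_U2_neg g d e : in_U2 g -> in_U2 (fun a b => g (a (+) d) (b (+) e)).
Proof.
move=> [gX gE]; case: (boolP (d (+) e)) => de; split=> H;
  [apply: gE | apply: gX | apply: gX | apply: gE] => a b;
  by move: (H (a (+) d) (b (+) e)); rewrite !addbK => ->;
     case: a; case: b; case: d e de {H} => [] [].
Qed.

Lemma in_U2_const d : in_U2 (fun _ _ => d).
Proof. by split=> H; move: (H true true) (H true false); case: d {H}. Qed.

(** The output gate that [assume_gate] adds has this form. *)
Lemma in_U2_mask (ob h : bool) : in_U2 (fun a b => (a (+) ob) && (b == h)).
Proof.
by split=> H; move: (H true true) (H true false) (H false true) (H false false);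
  case: ob h {H} => [] [].
Qed.

(** Fixing the first argument leaves two unary functions. If neither is constant, both are the
    identity up to negation; were they different, [g] would be xor or its complement. This is where
    excluding these two functions enters the lower bound. *)
Lemma in_U2_controlled g : in_U2 g ->
  (exists c d, forall b, g c b = d) \/ (exists e, forall a b, g a b = b (+) e).
Proof.
move=> [gX gE].
case tt: (g true true); case tf: (g true false);
  case ft: (g false true); case ff: (g false false);
  try (by left; exists true, true => -[]); try (by left; exists true, false => -[]);
  try (by left; exists false, true => -[]); try (by left; exists false, false => -[]);
  try (by right; exists true => -[] []); try (by right; exists false => -[] []);
  by exfalso; first [by apply: gX => -[] [] | by apply: gE => -[] []].
Qed.

Lemma unary_cases (g : bool -> bool) :
  (exists d, forall b, g b = d) \/ (exists e, forall b, g b = b (+) e).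
Proof.
case gt: (g true); case gf: (g false);
  try (by left; exists true => -[]); try (by left; exists false => -[]);
  by [right; exists true => -[] | right; exists false => -[]].
Qed.

(** * Circuits with named gates *)

(** [inl] tags the actual variables and [inr] the guesses. *)
Notation input := (nat + nat)%type.
Definition env := input -> bool.

Inductive node := NIn of input | NConst of bool | NGate of nat.

Definition node_code (w : node) : input + (bool + nat) :=
  match w with NIn a => inl a | NConst b => inr (inl b) | NGate k => inr (inr k) end.
Definition node_decode (c : input + (bool + nat)) : node :=
  match c with inl a => NIn a | inr (inl b) => NConst b | inr (inr k) => NGate k end.
Lemma node_codeK : cancel node_code node_decode. Proof. by case. Qed.
HB.instance Definition _ := Equality.copy node (can_type node_codeK).

(* Gates keep their names when others are deleted: only [ids] is significant,
   and the order of names is a topological order. *)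
Record dag := Dag {
  ids : seq nat;
  op : nat -> bool -> bool -> bool;
  lft : nat -> node;
  rgt : nat -> node;
  outn : node;
  outneg : bool }.

(** Gate values are a function constrained by [valn] rather than computed, so the same valuation
    survives the deletion of gates. *)
Definition valuation := nat -> env -> bool.

Definition nval (v : valuation) (p : env) (w : node) : bool :=
  match w with NIn a => p a | NConst b => b | NGate k => v k p end.

Definition live (A : seq nat) (w : node) := if w is NGate k then k \in A else true.
Definition below (n : nat) (w : node) := if w is NGate k then k < n else true.

Definition wf (C : dag) : Prop :=
  [/\ uniq (ids C),
      forall k, k \in ids C ->
        [/\ in_U2 (op C k), live (ids C) (lft C k) && below k (lft C k)
          & live (ids C) (rgt C k) && below k (rgt C k)]
    & live (ids C) (outn C)].

Definition valn (C : dag) (v : valuation) : Prop :=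
  forall k p, k \in ids C -> v k p = op C k (nval v p (lft C k)) (nval v p (rgt C k)).

Definition acc (C : dag) (v : valuation) (p : env) : bool :=
  nval v p (outn C) (+) outneg C.

Definition reads (C : dag) (k : nat) (w : node) : bool :=
  (lft C k == w) || (rgt C k == w).

Definition upd (p : env) (a : input) (c : bool) : env :=
  fun b => if b == a then c else p b.

Lemma upd_id p a c : p a = c -> upd p a c =1 p.
Proof. by move=> <- b; rewrite /upd; case: eqP => // ->. Qed.

Lemma nval_bound v v' p p' A n w :
  (forall k, k \in A -> k < n -> v k p = v' k p') -> (forall a, w = NIn a -> p a = p' a) ->
  live A w -> below n w -> nval v p w = nval v' p' w.
Proof. by case: w => //= [a|k] Hv Hp; [move=> _ _; apply: Hp | apply: Hv]. Qed.

Lemma reads_live C k w : wf C -> k \in ids C -> reads C k w -> live (ids C) w && below k w.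
Proof. by move=> [_ H _] /H [_ Hl Hr] /orP[] /eqP <-. Qed.

(** [U_2] is closed under exchanging arguments, so the node of interest can always be put first. *)
Lemma reads_view C v k w : wf C -> valn C v -> k \in ids C -> reads C k w ->
  exists g w', [/\ in_U2 g, reads C k w' & forall p, v k p = g (nval v p w) (nval v p w')].
Proof.
move=> [_ H _] Hv kC; have [gU _ _] := H _ kC.
case/orP=> /eqP <-.
- exists (op C k), (rgt C k); split=> //; first by rewrite /reads eqxx orbT.
  by move=> p; apply: Hv.
- exists (fun a b => op C k b a), (lft C k); split; first exact: in_U2_swap.
  + by rewrite /reads eqxx.
  + by move=> p; apply: Hv.
Qed.

(** Induction along the topological order. The first alternative serves a gate that reads a changed
    input but is known to keep its value, such as a blocked gate. *)
Lemma eq_on_gates C v p p' n : wf C -> valn C v ->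
  (forall k, k \in ids C -> k < n ->
     v k p = v k p' \/ forall a, reads C k (NIn a) -> p a = p' a) ->
  forall k, k \in ids C -> k < n -> v k p = v k p'.
Proof.
move=> Cwf Hv H; elim/ltn_ind=> k IH kC kn.
case: (H k kC kn) => // Ha.
have [_ Hg _] := Cwf; have [_ /andP[l1 l2] /andP[r1 r2]] := Hg _ kC.
have IH' j : j \in ids C -> j < k -> v j p = v j p'.
  by move=> jC jk; apply: IH => //; apply: ltn_trans kn.
rewrite !Hv //; congr (op C k _ _); apply: (nval_bound IH') => // a E; apply: Ha;
  by rewrite /reads E eqxx ?orbT.
Qed.

(** Used both as a bound above all gates and as a fresh name for a new last gate. *)
Definition gates_bound (C : dag) := (\max_(k <- ids C) k).+1.

Lemma lt_gates_bound C k : k \in ids C -> k < gates_bound C.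
Proof. by move=> kC; rewrite ltnS; apply: leq_bigmax_seq. Qed.

Lemma eq_on_acc C v p p' : wf C -> valn C v ->
  (forall k, k \in ids C -> v k p = v k p' \/ forall a, reads C k (NIn a) -> p a = p' a) ->
  (forall a, outn C = NIn a -> p a = p' a) -> acc C v p = acc C v p'.
Proof.
move=> Cwf Hv H Ho; congr (_ (+) _).
have [_ _ lo] := Cwf.
apply: (@nval_bound _ _ _ _ (ids C) (gates_bound C)) => //.
  by apply: eq_on_gates Cwf Hv _ => k kC _; apply: H.
by case: (outn C) lo => //= k; apply: lt_gates_bound.
Qed.

Lemma eq_acc C v p p' : wf C -> valn C v -> p =1 p' -> acc C v p = acc C v p'.
Proof. by move=> Cwf Hv E; apply: eq_on_acc => // k kC; right. Qed.

(** * Deleting gates *)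

(** The condition concerns values, not syntax. Constant gates are covered by a constant node [w];
    [below] keeps the order topological when readers are redirected to [w]. *)
Definition removable (A : seq nat) (v : valuation) (k : nat) : Prop :=
  exists w b, [/\ live A w, below k w & forall p, v k p = nval v p w (+) b].

Lemma removable_unary A v k w g : live A w -> below k w ->
  (forall p, v k p = g (nval v p w)) -> removable A v k.
Proof.
move=> lw bw E; case: (unary_cases g) => -[d Hd].
  by exists (NConst d), false; split=> // p; rewrite E Hd addbF.
by exists w, d; split=> // p; rewrite E Hd.
Qed.

Lemma removable_const A v k d : (forall p, v k p = d) -> removable A v k.
Proof. by move=> E; exists (NConst d), false; split=> // p; rewrite E addbF. Qed.

(** With one argument constant, the gate is a unary function of the other. *)
Lemma removable_const_reader C v k w d : wf C -> valn C v -> k \in ids C ->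
  reads C k w -> (forall p, nval v p w = d) -> removable (ids C) v k.
Proof.
move=> Cwf Hv kC /(reads_view Cwf Hv kC) [g [w' [_ rw' E]]] Ew.
have /andP[lw bw] := reads_live Cwf kC rw'.
by apply: (removable_unary (g := g d) lw bw) => p; rewrite E Ew.
Qed.

Definition replace_node (k : nat) (w0 w : node) := if w == NGate k then w0 else w.

(** The negation [b] is absorbed by the operations of the readers, and by [outneg] at the output, so
    no gate is spent on it. *)
Definition bypass (C : dag) (k : nat) (w0 : node) (b : bool) : dag :=
  let neg w := (w == NGate k) && b in
  Dag (rem k (ids C))
      (fun j x y => op C j (x (+) neg (lft C j)) (y (+) neg (rgt C j)))
      (fun j => replace_node k w0 (lft C j)) (fun j => replace_node k w0 (rgt C j))
      (replace_node k w0 (outn C)) (outneg C (+) neg (outn C)).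

Lemma live_rem A k w : uniq A -> live A w -> w != NGate k -> live (rem k A) w.
Proof.
move=> uA; case: w => //= j jA; rewrite mem_rem_uniq // inE jA andbT.
by apply: contra => /eqP ->.
Qed.

Lemma below_neq k w : below k w -> w != NGate k.
Proof. by case: w => //= j; apply: contraTneq => -[->]; rewrite ltnn. Qed.

Lemma remove1 C v k : wf C -> valn C v -> removable (ids C) v k ->
  exists C', [/\ wf C', valn C' v, ids C' = rem k (ids C) & forall p, acc C' v p = acc C v p].
Proof.
move=> [uC gC oC] Hv [w0 [b [lw0 bw0 Ek]]].
have lw0' := live_rem uC lw0 (below_neq bw0).
have nE p w : nval v p (replace_node k w0 w) (+) ((w == NGate k) && b) = nval v p w.
  by rewrite /replace_node; case: eqP => [->|_] /=; rewrite ?addbF // -Ek.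
have lR w : live (ids C) w -> live (rem k (ids C)) (replace_node k w0 w).
  by rewrite /replace_node; case: ifPn => // /(live_rem uC) H /H.
have bR j w : below j w -> below j (replace_node k w0 w).
  rewrite /replace_node; case: eqP => // -> /=.
  by case: w0 bw0 {lw0 Ek lw0' nE lR} => //= i; apply: ltn_trans.
exists (bypass C k w0 b); split=> //.
- split; [exact: rem_uniq | | exact: lR].
  move=> j /=; rewrite mem_rem_uniq // inE => /andP[_ jC].
  have [gU /andP[l1 l2] /andP[r1 r2]] := gC _ jC.
  by split; [exact: in_U2_neg | rewrite lR // bR | rewrite lR // bR].
- move=> j p /=; rewrite mem_rem_uniq // inE => /andP[_ jC].
  by rewrite !nE Hv.
- by move=> p; rewrite /acc /= addbC -addbA addbC; congr (_ (+) _); rewrite addbC nE.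
Qed.

(** If [k'] was to be replaced by [k] itself, it is replaced by the substitute of [k], and the two
    negations add up. *)
Lemma removable_rem A v k k' : uniq A -> removable A v k -> removable A v k' ->
  removable (rem k A) v k'.
Proof.
move=> uA [w [b [lw bw E]]] [w' [b' [lw' bw' E']]].
case: (eqVneq w' (NGate k)) bw' lw' E' => [-> /= kk' _ E' | ne bw' lw' E'].
  exists w, (b (+) b'); split; first exact: live_rem (below_neq bw).
    by case: w bw {lw E} => //= i; move/ltn_trans; apply.
  by move=> p; rewrite E' E addbA.
by exists w', b'; split=> //; apply: live_rem.
Qed.

Lemma remove_many S C v : wf C -> valn C v -> uniq S -> {subset S <= ids C} ->
  (forall k, k \in S -> removable (ids C) v k) ->
  exists C', [/\ wf C', valn C' v, size (ids C') + size S = size (ids C)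
    & forall p, acc C' v p = acc C v p].
Proof.
elim: S C => [|k S IH] C Cwf Hv /=; first by exists C; split; rewrite ?addn0.
move=> /andP[kS uS] sub rem_S.
have kC : k \in ids C by apply: sub; rewrite mem_head.
have rk := rem_S k (mem_head _ _).
have [C1 [C1wf Hv1 E1 acc1]] := remove1 Cwf Hv rk.
have [uC _ _] := Cwf.
have [j jS|j jS|C2 [C2wf Hv2 E2 acc2]] := IH C1 C1wf Hv1 uS.
- rewrite E1 mem_rem_uniq // inE; apply/andP; split; last by apply: sub; rewrite inE jS orbT.
  by apply: contraNneq kS => <-.
- by rewrite E1; apply: removable_rem => //; apply: rem_S; rewrite inE jS orbT.
exists C2; split=> //; last by move=> p; rewrite acc2 acc1.
rewrite addnS E2 E1 size_rem // prednK //.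
by case: (ids C) kC.
Qed.

Definition drop_gate (C : dag) (k : nat) : dag :=
  Dag (rem k (ids C)) (op C) (lft C) (rgt C) (outn C) (outneg C).

Lemma drop_gateP C v k : wf C -> valn C v ->
  (forall j, j \in ids C -> ~~ reads C j (NGate k)) -> outn C != NGate k ->
  wf (drop_gate C k) /\ valn (drop_gate C k) v.
Proof.
move=> [uC gC oC] Hv nr no; split; last first.
  by move=> j p /=; rewrite mem_rem_uniq // inE => /andP[_ jC]; apply: Hv.
split; [exact: rem_uniq | | exact: live_rem].
move=> j /=; rewrite mem_rem_uniq // inE => /andP[_ jC].
have [gU /andP[l1 l2] /andP[r1 r2]] := gC _ jC.
have := nr _ jC; rewrite negb_or => /andP[n1 n2].
by split=> //; apply/andP; split=> //; apply: live_rem.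
Qed.

(** * Fixing an input or a gate *)

Definition bind_node (a : input) (c : bool) (w : node) :=
  if w == NIn a then NConst c else w.

Definition bind (C : dag) (a : input) (c : bool) : dag :=
  Dag (ids C) (op C) (fun k => bind_node a c (lft C k)) (fun k => bind_node a c (rgt C k))
      (bind_node a c (outn C)) (outneg C).

(** Assignments keep their coordinate [a], but its value no longer matters. *)
Definition bind_val (v : valuation) a c : valuation := fun k p => v k (upd p a c).

Lemma nval_bind v p a c w :
  nval (bind_val v a c) p (bind_node a c w) = nval v (upd p a c) w.
Proof.
rewrite /bind_node; case: eqP => [->|ne] /=; first by rewrite /upd eqxx.
by case: w ne => //= b ne; rewrite /upd; case: eqP => // E; case: ne; rewrite E.
Qed.

Lemma acc_bind C v p a c : acc (bind C a c) (bind_val v a c) p = acc C v (upd p a c).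
Proof. by rewrite /acc nval_bind. Qed.

Lemma bindP C v a c : wf C -> valn C v ->
  wf (bind C a c) /\ valn (bind C a c) (bind_val v a c).
Proof.
move=> [uC gC oC] Hv.
have lB A w : live A w -> live A (bind_node a c w) by rewrite /bind_node; case: eqP.
have bB j w : below j w -> below j (bind_node a c w) by rewrite /bind_node; case: eqP.
split; last by move=> k p kC /=; rewrite !nval_bind; apply: Hv.
split=> //; last exact: lB.
move=> k kC; have [gU /andP[l1 l2] /andP[r1 r2]] := gC _ kC.
by split=> //=; rewrite lB ?bB.
Qed.

Lemma reads_bind_gate C a c k j : reads (bind C a c) k (NGate j) = reads C k (NGate j).
Proof.
have E w : (bind_node a c w == NGate j) = (w == NGate j).
  by rewrite /bind_node; case: (eqVneq w (NIn a)) => [->|].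
by rewrite /reads /= !E.
Qed.

Lemma reads_bind C a c k : reads C k (NIn a) -> reads (bind C a c) k (NConst c).
Proof. by rewrite /reads /= /bind_node => /orP[] /eqP ->; rewrite !eqxx ?orbT. Qed.

(** Arguments are found by name, so the recursion is on fuel. Any fuel above [k] gives the true
    value of gate [k], since its arguments have smaller names; the default [false] is then never
    reached. *)
Fixpoint fuel_val (C : dag) (fuel k : nat) (p : env) : bool :=
  if fuel is f.+1
  then op C k (nval (fuel_val C f) p (lft C k)) (nval (fuel_val C f) p (rgt C k))
  else false.

Lemma valn_exists C : wf C -> exists v, valn C v.
Proof.
move=> [uC gC oC].
have stable f : forall f' k p, k \in ids C -> k < f -> k < f' ->
    fuel_val C f k p = fuel_val C f' k p.
  elim: f => // f IH [|f'] k p kC // kf kf' /=.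
  have [_ /andP[l1 l2] /andP[r1 r2]] := gC _ kC.
  have H j : j \in ids C -> j < k -> fuel_val C f j p = fuel_val C f' j p.
    by move=> jC jk; apply: IH => //; apply: leq_trans jk _.
  by congr (op C k _ _); apply: (nval_bound H).
exists (fun k => fuel_val C k.+1 k) => k p kC /=.
have [_ /andP[l1 l2] /andP[r1 r2]] := gC _ kC.
have H j : j \in ids C -> j < k -> fuel_val C k j p = fuel_val C j.+1 j p.
  by move=> jC jk; apply: stable.
by congr (op C k _ _); apply: (nval_bound H).
Qed.

(* All readers of gate [q] see the constant [h] instead, and a new output gate
   checks that [q] really has value [h]. *)
Definition assume_gate (C : dag) (q : nat) (h : bool) : dag :=
  let N := gates_bound C in
  let old k (w w' : node) := if k == N then w' else replace_node q (NConst h) w in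
  Dag (N :: ids C)
      (fun k => if k == N then fun x y => (x (+) outneg C) && (y == h) else op C k)
      (fun k => old k (lft C k) (outn C)) (fun k => old k (rgt C k) (NGate q))
      (NGate N) false.

(** If [q] has value [h], the substitution changes no gate of [C]. Otherwise the new output gate
    rejects, and so does [C] by hypothesis. A new valuation is needed because gates after [q] may
    change in the second case. *)
Lemma assume_gateP C v q h : wf C -> valn C v -> q \in ids C ->
  (forall p, acc C v p -> v q p = h) ->
  exists v', [/\ wf (assume_gate C q h), valn (assume_gate C q h) v'
    & forall p, acc (assume_gate C q h) v' p = acc C v p].
Proof.
move=> Cwf Hv qC forced; have [uC gC oC] := Cwf.
set N := gates_bound C; set C' := assume_gate C q h.
have NC k : k \in ids C -> (k == N) = false.
  by move=> /lt_gates_bound /ltn_eqF.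
have lR w : live (ids C) w -> live (N :: ids C) (replace_node q (NConst h) w).
  by rewrite /replace_node; case: ifP => // _; case: w => //= k; rewrite inE => ->; rewrite orbT.
have bR j w : below j w -> below j (replace_node q (NConst h) w).
  by rewrite /replace_node; case: ifP.
have C'wf : wf C'.
  split=> /=; last by rewrite mem_head.
    by rewrite uC andbT; apply/negP => /lt_gates_bound; rewrite ltnn.
  move=> k; rewrite inE; case: eqP => [-> _ | _ /= kC]; last first.
    have [gU /andP[l1 l2] /andP[r1 r2]] := gC _ kC.
    by split=> //; rewrite lR ?bR.
  split; first exact: in_U2_mask; last by rewrite /= inE qC orbT lt_gates_bound.
  by case: (outn C) oC => //= j jC; rewrite inE jC orbT lt_gates_bound.
have [v' Hv'] := valn_exists C'wf; exists v'; split=> // p.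
have vE k : k \in ids C -> v' k p =
    op C k (nval v' p (replace_node q (NConst h) (lft C k)))
           (nval v' p (replace_node q (NConst h) (rgt C k))).
  by move=> kC; rewrite (Hv' k) /= ?inE ?kC ?orbT // NC.
(* Gates up to [q] do not read [q], so the output test sees the original value of [q]. *)
have eq_low k : k \in ids C -> k <= q -> v' k p = v k p.
  elim/ltn_ind: k => k IH kC kq.
  have [_ /andP[l1 l2] /andP[r1 r2]] := gC _ kC.
  have IH' j : j \in ids C -> j < k -> v' j p = v j p.
    by move=> jC jk; apply: IH => //; apply: leq_trans kq; apply: ltnW.
  have low w : below k w -> replace_node q (NConst h) w = w.
    rewrite /replace_node; case: eqP => // -> /= qk.
    by move: kq; rewrite leqNgt qk.
  rewrite vE // Hv // !low //.
  by congr (op C k _ _); apply: (nval_bound IH').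
have eq_all k : v q p = h -> k \in ids C -> v' k p = v k p.
  move=> qh; elim/ltn_ind: k => k IH kC.
  have [_ /andP[l1 l2] /andP[r1 r2]] := gC _ kC.
  have sim w : live (ids C) w -> below k w -> nval v' p (replace_node q (NConst h) w) = nval v p w.
    move=> lw bw; rewrite /replace_node; case: eqP => [->|_] //=.
    by apply: (nval_bound (A := ids C) (n := k)) => // j jC jk; apply: IH.
  by rewrite vE // Hv // !sim.
rewrite /acc /= addbF (Hv' N) /= ?inE ?eqxx //= eq_low //.
case: eqP => qh; rewrite ?andbT ?andbF.
  congr (_ (+) _).
  by case: (outn C) oC => //= k kC; apply: eq_all.
by apply/esym/negP => /forced.
Qed.

(** * Parity-like functions *)

(** The parity of the inputs in [V] up to complement, a class closed under fixing an input. *)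
Definition parity_on (V : seq input) (F : env -> bool) : Prop :=
  (forall p p', {in V, p =1 p'} -> F p = F p') /\
  (forall a p, a \in V -> F (upd p a (~~ p a)) = ~~ F p).

(* Every input outside [V] plays the role of a guess. *)
Definition computes (C : dag) (v : valuation) (V : seq input) (F : env -> bool) : Prop :=
  (forall p, acc C v p -> F p) /\
  (forall p, F p -> exists2 p', {in V, p =1 p'} & acc C v p').

Definition realizes (C : dag) (v : valuation) V F : Prop :=
  [/\ wf C, valn C v & computes C v V F].

Definition realizable V F s : Prop := exists C v, realizes C v V F /\ size (ids C) = s.

Lemma eq_acc_computes C C' v v' V F : (forall p, acc C' v' p = acc C v p) ->
  computes C v V F -> computes C' v' V F.
Proof.
move=> E [snd cpl]; split=> p; first by rewrite E; apply: snd.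
by move=> /cpl [p' Vp' a]; exists p' => //; rewrite E.
Qed.

Lemma parity_on_bind V F a c : uniq V -> parity_on V F ->
  parity_on (rem a V) (fun p => F (upd p a c)).
Proof.
move=> uV [ext flip]; split=> [p p' E|b p].
  apply: ext => b bV; rewrite /upd; case: eqP => // /eqP ne.
  by apply: E; rewrite mem_rem_uniq // inE ne.
rewrite mem_rem_uniq // inE => /andP[ne bV].
rewrite -(flip b) //; apply: ext => d _; rewrite /upd (negbTE ne).
by case: (eqVneq d a) => // ->; rewrite eq_sym (negbTE ne).
Qed.

Lemma bind_realizes C v V F a c : uniq V -> parity_on V F -> realizes C v V F -> a \in V ->
  realizes (bind C a c) (bind_val v a c) (rem a V) (fun p => F (upd p a c)).
Proof.
move=> uV parF [Cwf Hv [snd cpl]] aV; have [Bwf BHv] := bindP a c Cwf Hv.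
split=> //; split=> p; first by rewrite acc_bind; apply: snd.
move=> /cpl [p' Vp' ap']; exists p'.
  move=> b; rewrite mem_rem_uniq // inE => /andP[ne bV].
  by rewrite -Vp' // /upd (negbTE ne).
rewrite acc_bind (@eq_acc _ _ _ p') //; apply: upd_id.
by rewrite -Vp' // /upd eqxx.
Qed.

(** Soundness survives because [F] ignores [a], completeness because every accepting computation
    already has [a] equal to [c]. *)
Lemma bind_guess_realizes C v V F a c : parity_on V F -> realizes C v V F -> a \notin V ->
  (forall p, acc C v p -> p a = c) -> realizes (bind C a c) (bind_val v a c) V F.
Proof.
move=> [ext flip] [Cwf Hv [snd cpl]] aV forced; have [Bwf BHv] := bindP a c Cwf Hv.
split=> //; split=> p.
  rewrite acc_bind => /snd; rewrite (ext _ p) // => b bV.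
  by rewrite /upd; case: eqP => // E; rewrite -E bV in aV.
move=> /cpl [p' Vp' ap']; exists p' => //.
by rewrite acc_bind (@eq_acc _ _ _ p') //; apply: upd_id; apply: forced.
Qed.

Lemma acc_exists C v V F a : parity_on V F -> realizes C v V F -> a \in V ->
  exists p, acc C v p.
Proof.
move=> [ext flip] [_ _ [snd cpl]] aV.
pose p0 : env := fun=> false.
case F0: (F p0); first by have [p _ ap] := cpl _ F0; exists p.
have /cpl [p _ ap] : F (upd p0 a (~~ p0 a)) by rewrite flip // F0.
by exists p.
Qed.

(** By soundness the flipped input is rejected under every choice of guesses, in particular under
    the unchanged ones. Sensitivity is thus available at accepting computations only. *)
Lemma acc_flip C v V F a p : parity_on V F -> realizes C v V F -> a \in V ->
  acc C v p -> acc C v (upd p a (~~ p a)) = false.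
Proof.
move=> [ext flip] [_ _ [snd cpl]] aV /snd Fp.
by apply/negP => /snd; rewrite flip // Fp.
Qed.

Lemma acc_not_const C v V F a e : parity_on V F -> realizes C v V F -> a \in V ->
  ~ (forall p, acc C v p = e).
Proof.
move=> parF rF aV E; have [p ap] := acc_exists parF rF aV.
by have := acc_flip parF rF aV ap; rewrite E -(E p) ap.
Qed.

Lemma remove_realizable C v V F S : realizes C v V F -> uniq S -> {subset S <= ids C} ->
  (forall k, k \in S -> removable (ids C) v k) ->
  realizable V F (size (ids C) - size S).
Proof.
move=> [Cwf Hv cF] uS sub rS; have [C' [C'wf Hv' E a]] := remove_many Cwf Hv uS sub rS.
exists C', v; split; last by rewrite -E addnK.
by split=> //; apply: eq_acc_computes cF.
Qed.

Lemma remove1_realizable C v V F k : realizes C v V F -> k \in ids C ->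
  removable (ids C) v k -> realizable V F (size (ids C)).-1.
Proof.
move=> rF kC rk; rewrite -subn1.
apply: (@remove_realizable C v V F [:: k]) => // j; first by rewrite inE => /eqP ->.
by rewrite inE => /eqP ->.
Qed.

Lemma drop_realizes C v V F k : realizes C v V F ->
  (forall j, j \in ids C -> ~~ reads C j (NGate k)) -> outn C != NGate k ->
  realizes (drop_gate C k) v V F.
Proof.
by move=> [Cwf Hv cF] nr no; have [] := drop_gateP Cwf Hv nr no; split.
Qed.

(** * Gate elimination *)

(** A gate that depends on at most one node, because its arguments coincide or one is ignored, can
    be bypassed. Otherwise each argument has a value that blocks the other. *)
Lemma reader_cases C v g w : wf C -> valn C v -> g \in ids C -> reads C g w ->
  removable (ids C) v g \/
  exists f w', [/\ reads C g w' && (w' != w), forall p, v g p = f (nval v p w) (nval v p w'),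
    exists c d, forall x, f c x = d & exists h d, forall x, f x h = d].
Proof.
move=> Cwf Hv gC rw; have [f [w' [fU rw' E]]] := reads_view Cwf Hv gC rw.
have /andP[lw bw] := reads_live Cwf gC rw; have /andP[lw' bw'] := reads_live Cwf gC rw'.
have [Ew|ne] := eqVneq w' w.
  by left; apply: (removable_unary (g := fun x => f x x) lw bw) => p; rewrite E Ew.
case: (in_U2_controlled fU) => [H1|[e He]]; last first.
  by left; exists w', e; split=> // p; rewrite E He.
case: (in_U2_controlled (in_U2_swap fU)) => [H2|[e He]]; last first.
  by left; exists w, e; split=> // p; rewrite E He.
by right; exists f, w'; rewrite rw' ne; split.
Qed.

Lemma unread_cases C v V F g : realizes C v V F -> g \in ids C ->
  [\/ exists2 k, k \in ids C & reads C k (NGate g), outn C = NGate g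
    | realizable V F (size (ids C)).-1].
Proof.
move=> rF gC; case: (boolP (has (fun k => reads C k (NGate g)) (ids C))) => [/hasP|/hasPn] nr.
  by apply: Or31.
have [|no] := eqVneq (outn C) (NGate g); first by move=> E; apply: Or32.
apply: Or33; exists (drop_gate C g), v; split; first exact: drop_realizes.
by rewrite /= size_rem.
Qed.

(** Were [g] the output, fixing [a] would make the circuit constant, although its function still
    depends on [b]. *)
Lemma blocked_gate_read C v V F a b c g d : uniq V -> parity_on V F -> realizes C v V F ->
  a \in V -> b \in rem a V -> g \in ids C -> (forall p, bind_val v a c g p = d) ->
  (exists2 k, k \in ids C & reads C k (NGate g)) \/ realizable V F (size (ids C)).-1.
Proof.
move=> uV parF rF aV bV gC E.
case: (unread_cases rF gC) => [|Eo|]; [by left| |by right].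
have rB := bind_realizes c uV parF rF aV; have pB := parity_on_bind a c uV parF.
case: (@acc_not_const _ _ _ _ b (d (+) outneg C) pB rB bV) => p.
by rewrite /acc /= Eo /bind_node /= E.
Qed.

(** One step of the induction: in both cases the bound [3 * (size V - 1)] carries over from the
    smaller instance. The guard [3 <= s] prevents truncation of [s - 3]. *)
Definition shrinks V F s : Prop :=
  (exists2 s', s' < s & realizable V F s') \/
  (exists a c, [/\ a \in V, 3 <= s & realizable (rem a V) (fun p => F (upd p a c)) (s - 3)]).

Lemma shrinks_pred C V F k : k \in ids C -> realizable V F (size (ids C)).-1 ->
  shrinks V F (size (ids C)).
Proof. by move=> kC H; left; exists (size (ids C)).-1 => //; case: (ids C) kC => /=. Qed.

(** Making the later reader [k2] constant ensures that its own reader [k3] is a third gate; the only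
    reader of [k1] might be [k2]. *)
Lemma shrinks_two_readers C v V F a b k1 k2 : uniq V -> parity_on V F -> realizes C v V F ->
  a \in V -> b \in rem a V -> k1 \in ids C -> k2 \in ids C -> k1 < k2 ->
  reads C k1 (NIn a) -> reads C k2 (NIn a) -> shrinks V F (size (ids C)).
Proof.
move=> uV parF rF aV bV k1C k2C k12 r1 r2; have [Cwf Hv _] := rF.
case: (reader_cases Cwf Hv k2C r2) => [rm|[f [w [_ E [c [d Hf]] _]]]].
  exact: shrinks_pred k2C (remove1_realizable rF k2C rm).
have Ed p : bind_val v a c k2 p = d by rewrite /bind_val E /= {1}/upd eqxx Hf.
case: (blocked_gate_read uV parF rF aV bV k2C Ed) => [[k3 k3C r3]|]; last exact: shrinks_pred k2C.
have /andP[_ /= k23] := reads_live Cwf k3C r3.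
have rB := bind_realizes c uV parF rF aV; have [Bwf BHv _] := rB.
have uS : uniq [:: k1; k2; k3].
  by rewrite /= !inE negb_or !andbT (ltn_eqF k12) (ltn_eqF k23) (ltn_eqF (ltn_trans k12 k23)).
have sub : {subset [:: k1; k2; k3] <= ids C}.
  by move=> k; rewrite !inE => /or3P[] /eqP ->.
right; exists a, c; split=> //; first exact: (uniq_leq_size uS sub).
apply: (remove_realizable rB uS) => // k; rewrite !inE => /or3P[] /eqP ->.
- by apply: (removable_const_reader (d := c) Bwf BHv k1C (reads_bind c r1)).
- exact: removable_const Ed.
- by apply: (removable_const_reader (w := NGate k2) Bwf BHv k3C _ Ed); rewrite reads_bind_gate.
Qed.

(* The gate [q] only feeds [g], so it is no longer needed once [g] is constant. *)
Lemma shrinks_private_gate C v V F a b c d g q : uniq V -> parity_on V F -> realizes C v V F ->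
  a \in V -> b \in rem a V -> g \in ids C -> q \in ids C -> q < g -> outn C != NGate q ->
  (forall p, bind_val v a c g p = d) ->
  (forall k, k \in ids C -> reads C k (NGate q) -> k = g) -> shrinks V F (size (ids C)).
Proof.
move=> uV parF rF aV bV gC qC qg oq Ed only_g; have [Cwf _ _] := rF.
case: (blocked_gate_read uV parF rF aV bV gC Ed) => [[k kC rk]|]; last exact: shrinks_pred gC.
have /andP[_ /= gk] := reads_live Cwf kC rk.
have rB := bind_realizes c uV parF rF aV; have [Bwf BHv Bc] := rB.
pose v' := bind_val v a c.
pose cst (w : nat -> node) j := if j == g then NConst d else w j.
pose B := bind C a c.
pose D := Dag (ids B) (fun j => if j == g then fun _ _ => d else op B j)
              (cst (lft B)) (cst (rgt B)) (outn B) (outneg B).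
have rD : realizes D v' (rem a V) (fun p => F (upd p a c)).
  split; last exact: Bc.
    have [uB gB oB] := Bwf; split=> // j jC; rewrite /= /cst; case: eqP => _; last exact: gB.
    by split=> //; apply: in_U2_const.
  by move=> j p jC; rewrite /= /cst; case: eqP => [->|_]; [apply: Ed | apply: BHv].
have rDq : realizes (drop_gate D q) v' (rem a V) (fun p => F (upd p a c)).
  apply: drop_realizes rD _ _; last first.
    by rewrite /= /bind_node; case: (eqVneq (outn C) (NIn a)).
  move=> j jC; rewrite /reads /= /cst; case: (eqVneq j g) => // jg.
  have := reads_bind_gate C a c j q; rewrite /reads /= => ->.
  by apply: contraNN jg => H; apply/eqP/only_g.
have [uC _ _] := Cwf; have [Dwf DHv _] := rDq.
have gD : g \in ids (drop_gate D q).
  by rewrite /= mem_rem_uniq // inE gC andbT gtn_eqF.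
(* Since [q < g < k], the reader [k] is a third gate. *)
have kD : k \in ids (drop_gate D q).
  by rewrite /= mem_rem_uniq // inE kC andbT gtn_eqF // (ltn_trans qg).
have uS : uniq [:: g; k] by rewrite /= inE ltn_eqF.
have sub : {subset [:: g; k] <= ids (drop_gate D q)}.
  by move=> j; rewrite !inE => /orP[] /eqP ->.
have szD : size (ids (drop_gate D q)) = (size (ids C)).-1 by rewrite /= size_rem.
have := uniq_leq_size uS sub; rewrite szD /= => sz.
right; exists a, c; split=> //; first by lia.
have -> : size (ids C) - 3 = size (ids (drop_gate D q)) - size [:: g; k].
  by rewrite szD /=; lia.
apply: (remove_realizable rDq uS sub) => j; rewrite !inE => /orP[] /eqP ->.
  exact: removable_const Ed.
apply: (removable_const_reader (w := NGate g) Dwf DHv kD _ Ed).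
have := reads_bind_gate C a c k g; rewrite rk /reads /= /cst.
by rewrite (gtn_eqF gk).
Qed.

(** The new output gate costs one gate, and both readers of [q] now see a constant and go: a net
    saving of one with [V] and [F] unchanged. *)
Lemma shrinks_shared_gate C v V F g g' q h : realizes C v V F ->
  g \in ids C -> g' \in ids C -> q \in ids C -> g != g' ->
  reads C g (NGate q) -> reads C g' (NGate q) -> (forall p, acc C v p -> v q p = h) ->
  shrinks V F (size (ids C)).
Proof.
move=> [Cwf Hv cF] gC g'C qC gg' rg rg' forced.
have [v' [Awf AHv Aacc]] := assume_gateP Cwf Hv qC forced.
have rA : realizes (assume_gate C q h) v' V F by split=> //; apply: eq_acc_computes cF.
have uS : uniq [:: g; g'] by rewrite /= inE gg'.
have sub : {subset [:: g; g'] <= ids C}.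
  by move=> j; rewrite !inE => /orP[] /eqP ->.
have subA : {subset [:: g; g'] <= ids (assume_gate C q h)}.
  by move=> j /sub jC; rewrite /= inE jC orbT.
have sz := uniq_leq_size uS sub.
left; exists (size (ids (assume_gate C q h)) - 2); first by move: sz => /=; lia.
apply: (remove_realizable rA uS subA) => j jS.
apply: (removable_const_reader (w := NConst h) (d := h) Awf AHv (subA _ jS)) => //.
have rj : reads C j (NGate q) by move: jS; rewrite !inE => /orP[] /eqP ->.
rewrite /reads /= (ltn_eqF (lt_gates_bound (sub _ jS))) /replace_node.
by move: rj; rewrite /reads => /orP[] /eqP ->; rewrite !eqxx ?orbT.
Qed.

(** Otherwise flipping [b] would not affect acceptance. *)
Lemma out_not_input C v V F a b : parity_on V F -> realizes C v V F ->
  b \in V -> b != a -> outn C != NIn a.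
Proof.
move=> parF rF bV ba; have [p ap] := acc_exists parF rF bV.
apply/eqP => Eo; have := acc_flip parF rF bV ap.
by rewrite /acc Eo /= /upd eq_sym (negbTE ba); move: ap; rewrite /acc Eo /= => ->.
Qed.

(* If [x_a] enters only [g] and the other argument of [g] blocks it, then flipping
   [x_a] changes nothing; so acceptance forces that argument to the other value. *)
Lemma accepting_unblocked C v V F a b g f w h d : parity_on V F -> realizes C v V F ->
  a \in V -> b \in V -> b != a -> g \in ids C ->
  (forall k, k \in ids C -> reads C k (NIn a) -> k = g) ->
  reads C g w -> w != NIn a -> (forall p, v g p = f (nval v p (NIn a)) (nval v p w)) ->
  (forall x, f x h = d) -> forall p, acc C v p -> nval v p w = ~~ h.
Proof.
move=> parF rF aV bV ba gC only_g rw wa E Hf p ap; have [Cwf Hv _] := rF.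
have ob := out_not_input parF rF bV ba.
have [wh|] := eqVneq (nval v p w) h; last by case: (nval v p w); case: (h).
set p' := upd p a (~~ p a).
have other k : k \in ids C -> k != g -> forall x, reads C k (NIn x) -> p x = p' x.
  move=> kC kg x rx; rewrite /p' /upd; case: eqP => // xa.
  by case/eqP: kg; apply: only_g => //; rewrite -xa.
have /andP[lw bw] := reads_live Cwf gC rw.
(* [w] is not the input [a], and its value depends only on gates below [g], none of which reads
   [a]. *)
have wE : nval v p w = nval v p' w.
  apply: (@nval_bound _ _ _ _ (ids C) g) => //.
    apply: eq_on_gates Cwf Hv _ => k kC kg; right; apply: other => //.
    by rewrite ltn_eqF.
  by move=> x wx; rewrite /p' /upd; case: eqP => // xa; rewrite wx xa eqxx in wa.
have gE : v g p = v g p' by rewrite !E -wE wh !Hf.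
have := acc_flip parF rF aV ap.
suff -> : acc C v p' = acc C v p by rewrite ap.
apply/esym/eq_on_acc => // [k kC|x ox].
  by have [->|kg] := eqVneq k g; [left | right; apply: other].
by rewrite /p' /upd; case: eqP => // xa; rewrite ox xa eqxx in ob.
Qed.

Lemma input_read C v V F a b : parity_on V F -> realizes C v V F ->
  a \in V -> b \in V -> b != a -> exists2 k, k \in ids C & reads C k (NIn a).
Proof.
move=> parF rF aV bV ba; have [Cwf Hv _] := rF.
apply/hasP; apply/contraT => /hasPn nr; have [p ap] := acc_exists parF rF aV.
have := acc_flip parF rF aV ap.
suff -> : acc C v (upd p a (~~ p a)) = acc C v p by rewrite ap.
apply/esym/eq_on_acc => // [k kC|x ox].
  right=> x rx; rewrite /upd; case: eqP => // xa.
  by have := nr _ kC; rewrite -xa rx.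
rewrite /upd; case: eqP => // xa.
by have := out_not_input parF rF bV ba; rewrite ox xa eqxx.
Qed.

(** Flipping both [a] and [b] in an accepting computation preserves [F], so completeness yields
    another one with the opposite value of [b]. *)
Lemma input_not_forced C v V F a b h : parity_on V F -> realizes C v V F ->
  a \in V -> b \in V -> b != a -> ~ (forall p, acc C v p -> p b = h).
Proof.
move=> parF rF aV bV ba forced; have [p ap] := acc_exists parF rF aV.
have [_ flip] := parF; have [_ _ [snd cpl]] := rF.
pose q := upd p a (~~ p a).
have /cpl [p' Vp' ap'] : F (upd q b (~~ q b)) by rewrite !flip // negbK snd.
have := Vp' b bV; rewrite (forced _ ap') /upd eqxx /q /upd (negbTE ba) (forced _ ap).
by case: (h).
Qed.

Lemma realizable_shrinks V F s : uniq V -> parity_on V F -> 1 < size V ->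
  realizable V F s -> shrinks V F s.
Proof.
case: V => [|a [|b V0]] // uV parF _ [C [v [rF <-]]].
set V := [:: a, b & V0] in uV parF rF *.
have aV : a \in V by rewrite !inE eqxx.
have bV : b \in V by rewrite !inE eqxx orbT.
have ba : b != a by move: uV; rewrite /= inE negb_or eq_sym => /andP[/andP[]].
have bVa : b \in rem a V by rewrite mem_rem_uniq // inE ba.
have [Cwf Hv _] := rF.
have [g gC rg] := input_read parF rF aV bV ba.
have [/hasP [k kC /andP[kg rk]]|/hasPn only] :=
    boolP (has (fun k => (k != g) && reads C k (NIn a)) (ids C)).
  case: (ltngtP k g) kg => // kg _.
    exact: shrinks_two_readers uV parF rF aV bVa kC gC kg rk rg.
  exact: shrinks_two_readers uV parF rF aV bVa gC kC kg rg rk.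
have only_g k : k \in ids C -> reads C k (NIn a) -> k = g.
  by move=> /only; rewrite negb_and negbK => /orP[/eqP|/negbTE ->].
case: (reader_cases Cwf Hv gC rg) => [rm|].
  exact: shrinks_pred gC (remove1_realizable rF gC rm).
move=> [f [w [/andP[rw wa] E [c [d fc]] [h [e fh]]]]].
have forced := accepting_unblocked parF rF aV bV ba gC only_g rw wa E fh.
case: w rw wa E forced => [x|x|q] rw wa E forced.
(* No variable of [V] other than [a] is forced, so [x] is a guess. It is fixed to its forced value,
   which makes [g] unary. *)
- have [xV|xV] := boolP (x \in V).
    by case: (input_not_forced parF rF aV xV _ forced); apply: contraNneq wa => ->.
  have rB := bind_guess_realizes parF rF xV forced; have [Bwf BHv _] := rB.
  apply: (shrinks_pred gC); apply: (remove1_realizable rB gC).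
  exact: (removable_const_reader (d := ~~ h) Bwf BHv gC (reads_bind _ rw)).
- apply: (shrinks_pred gC); apply: (remove1_realizable rF gC).
  exact: (removable_const_reader (d := x) Cwf Hv gC rw).
have /andP[/= qC qg] := reads_live Cwf gC rw.
have [/hasP [k kC /andP[kg rk]]|/hasPn only_q] :=
    boolP (has (fun k => (k != g) && reads C k (NGate q)) (ids C)).
  by apply: (shrinks_shared_gate rF kC gC qC kg rk rw forced).
apply: (shrinks_private_gate (d := d) (c := c) uV parF rF aV bVa gC qC qg).
(* Were [q] the output, flipping [a] would not affect acceptance: [q] lies below [g], the only
   reader of [a]. *)
- apply/eqP => Eo; have [p ap] := acc_exists parF rF aV.
  have := acc_flip parF rF aV ap; move: ap; rewrite /acc Eo /=.
  rewrite -(_ : v q p = v q (upd p a (~~ p a))) => [->//|].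
  apply: (eq_on_gates (n := g) Cwf Hv _ qC qg) => k kC kg; right=> x rx.
  rewrite /upd; case: eqP => // xa.
  by move: kg; rewrite (only_g k kC) ?ltnn // -xa.
- by move=> p; rewrite /bind_val E /= {1}/upd eqxx fc.
- by move=> k /only_q; rewrite negb_and negbK => /orP[/eqP|/negbTE ->].
Qed.

(** Strong induction on [s] for all [V] and [F], since fixing a variable changes both. For at most
    one variable the truncated bound is 0. *)
Lemma realizable_size_ge s V F : uniq V -> parity_on V F -> realizable V F s ->
  3 * (size V - 1) <= s.
Proof.
elim/ltn_ind: s V F => s IH V F uV parF rF.
have [|V1] := leqP (size V) 1; first by case: (size V) => [|[|]].
case: (realizable_shrinks uV parF V1 rF) => [[s' s's r]|[a [c [aV s3 r]]]].
  exact: leq_trans (IH _ s's _ _ uV parF r) (ltnW s's).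
have /IH H : s - 3 < s by lia.
have := H _ _ (rem_uniq a uV) (parity_on_bind a c uV parF) r.
by rewrite size_rem //; lia.
Qed.

(** * Translation to and from the list presentation *)

Lemma eval_gates_rcons x y gs g : eval_gates x y (rcons gs g) =
  rcons (eval_gates x y gs) (gfun g (eval_wire x y (eval_gates x y gs) (gleft g))
                                    (eval_wire x y (eval_gates x y gs) (gright g))).
Proof. by rewrite /eval_gates foldl_rcons. Qed.

Lemma size_eval_gates x y gs : size (eval_gates x y gs) = size gs.
Proof. by elim/last_ind: gs => // gs g IH; rewrite eval_gates_rcons !size_rcons IH. Qed.

Notation gate0 := (Gate (fun _ _ => false) (WConst false) (WConst false)).

(** Each gate is evaluated against the values before it. Its wires point only there, so the equation
    still holds against the complete list, as [valn] requires. *)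
Lemma nth_eval_gates n m x y gs k : k < size gs ->
  (forall k, k < size gs -> wire_ok n m k (gleft (nth gate0 gs k))
                         /\ wire_ok n m k (gright (nth gate0 gs k))) ->
  let vals := eval_gates x y gs in
  nth false vals k = gfun (nth gate0 gs k) (eval_wire x y vals (gleft (nth gate0 gs k)))
                                           (eval_wire x y vals (gright (nth gate0 gs k))).
Proof.
elim/last_ind: gs k => // gs g IH k ks ok /=; rewrite eval_gates_rcons.
set vals := eval_gates x y gs; set b := gfun g _ _.
have szv : size vals = size gs by apply: size_eval_gates.
have ext j w : j <= size gs -> wire_ok n m j w ->
    eval_wire x y (rcons vals b) w = eval_wire x y vals w.
  case: w => //= i js ij; rewrite nth_rcons szv ifT //; exact: leq_trans js.
have [okl okr] := ok k ks; move: ks okl okr; rewrite size_rcons ltnS => ks okl okr.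
rewrite !(ext k) //; rewrite !nth_rcons szv.
move: ks; rewrite leq_eqVlt => /orP[/eqP ->|ks]; first by rewrite ltnn eqxx.
rewrite ks IH // => j js.
by have := ok j; rewrite size_rcons nth_rcons js ltnS ltnW //; apply.
Qed.

Definition node_of (w : wire) : node :=
  match w with
  | WVar i => NIn (inl i) | WGuess j => NIn (inr j)
  | WConst b => NConst b | WGate k => NGate k
  end.

Lemma parity_flip n (x x' : nat -> bool) i : i < n -> x' i = ~~ x i ->
  (forall j, j != i -> x' j = x j) -> parity n x' = ~~ parity n x.
Proof.
move=> i_n xi xj; rewrite /parity !(bigD1 (Ordinal i_n) (P := predT)) //= xi.
rewrite (eq_bigr (fun j : 'I_n => x j : nat)) => [|j]; last first.
  by move=> ne; rewrite xj //; apply: contra ne => /eqP E; apply/eqP/val_inj.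
by rewrite !oddD !oddb addNb.
Qed.

Lemma parity_on_parity n :
  parity_on [seq inl i | i <- iota 0 n] (fun p : env => parity n (fun i => p (inl i))).
Proof.
split=> [p p' E|a p].
  rewrite /parity; congr odd; apply: eq_bigr => i _.
  by rewrite E // map_f // mem_iota /=.
case/mapP => i; rewrite mem_iota add0n => /andP[_ i_n] ->.
apply: (parity_flip i_n) => [|j ne]; rewrite /upd ?eqxx //.
by case: eqP => // -[] E; rewrite E eqxx in ne.
Qed.

Lemma circuit_realizable n m C : U2_circuit n m C -> ndc_computes n m C (parity n) ->
  realizable [seq inl i | i <- iota 0 n] (fun p : env => parity n (fun i => p (inl i)))
             (csize C).
Proof.
move=> [okC okO] comp; set gs := gates C.
pose xs (p : env) i := p (inl i); pose ys (p : env) j := p (inr j).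
pose v : valuation := fun k p => nth false (eval_gates (xs p) (ys p) gs) k.
pose gt k := nth gate0 gs k.
pose D := Dag (iota 0 (size gs)) (fun k => gfun (gt k))
  (fun k => node_of (gleft (gt k))) (fun k => node_of (gright (gt k))) (node_of (out C)) false.
have nE p w : nval v p (node_of w) = eval_wire (xs p) (ys p) (eval_gates (xs p) (ys p) gs) w.
  by case: w.
have lE k w : wire_ok n m k w -> k <= size gs ->
    live (iota 0 (size gs)) (node_of w) && below k (node_of w).
  by case: w => //= i ik ks; rewrite mem_iota add0n ik andbT (leq_trans ik).
have accE p : acc D v p = eval_circuit (xs p) (ys p) C by rewrite /acc nE addbF.
exists D, v; split; last by rewrite /= size_iota.
split.
- split=> /=; [exact: iota_uniq | | by have /andP[] := lE _ _ okO (leqnn _)].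
  move=> k; rewrite mem_iota add0n => /andP[_ ks].
  have [gU [ol or]] := okC k ks.
  by split=> //; apply: lE => //; apply: ltnW.
- move=> k p; rewrite mem_iota add0n => /andP[_ ks] /=; rewrite !nE.
  by apply: (@nth_eval_gates n m) => // j js; have [_ []] := okC j js.
- split=> p; first by rewrite accE => ap; apply/comp; exists (ys p).
  (* The accepting assignment takes its variables from [p] and its guesses from [y]. *)
  move=> /comp [y ay]; exists (fun a => if a is inr j then y j else p a); last by rewrite accE.
  by move=> a /mapP [i _ ->].
Qed.

(** * The upper bound *)

(** Block [n'] of three gates occupies the positions from [3 * n'] to [3 * n' + 2], and its last
    gate carries the result. Without blocks the result is the input [x_0]. *)
Definition parity_out (n : nat) : wire := if n is n'.+1 then WGate (3 * n' + 2) else WVar 0.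

(* Computes [x_0 (+) ... (+) x_n], for [n] one less than the number of variables. *)
Fixpoint parity_gates (n : nat) : seq gate :=
  if n is n'.+1 then
    parity_gates n' ++
      [:: Gate (fun a b => a && ~~ b) (parity_out n') (WVar n);
          Gate (fun a b => ~~ a && b) (parity_out n') (WVar n);
          Gate orb (WGate (3 * n')) (WGate (3 * n').+1)]
  else [::].

Lemma size_parity_gates n : size (parity_gates n) = 3 * n.
Proof. by elim: n => //= n IH; rewrite size_cat IH /=; lia. Qed.

Lemma parity_gates_ok n m k : k < 3 * n ->
  let g := nth gate0 (parity_gates n) k in
  in_U2 (gfun g) /\ wire_ok n.+1 m k (gleft g) /\ wire_ok n.+1 m k (gright g).
Proof.
elim: n k => // n IH k kn /=; rewrite nth_cat size_parity_gates.
have widen j w : wire_ok n.+1 m j w -> wire_ok n.+2 m j w.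
  by case: w => //= i; apply: ltnW.
case: ltnP => [kn'|kn'].
  by have [gU [/widen ? /widen ?]] := IH _ kn'; split.
have [i [i3 ->]] : exists i, i < 3 /\ k = 3 * n + i by exists (k - 3 * n); split; lia.
rewrite addKn.
have okO j : 3 * n <= j -> wire_ok n.+2 m j (parity_out n).
  by case: n {IH kn kn' widen} => //= n; lia.
(* These truth tables have one or three true entries; xor and its complement have two. *)
have U g : (g true true, g true false, g false true, g false false) = (false, true, false, false) \/
    (g true true, g true false, g false true, g false false) = (false, false, true, false) \/
    (g true true, g true false, g false true, g false false) = (true, true, true, false) -> in_U2 g.
  by move=> H; split=> E; move: H; rewrite !E /= => -[|[|]].
case: i i3 => [|[|[|]]] //= _; split; rewrite ?okO ?leq_addr //=; try lia; apply: U; auto.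
Qed.

(** With [z] the parity so far, each block computes the xor of [z] and the next variable [x] as
    [(z && ~~ x) || (~~ z && x)]. *)
Lemma parity_gates_eval n x y :
  eval_wire x y (eval_gates x y (parity_gates n)) (parity_out n) = parity n.+1 x.
Proof.
elim: n => [|n IH]; first by rewrite /parity big_ord_recr big_ord0 /=; case: (x 0).
rewrite /parity big_ord_recr oddD -/(parity n.+1 x) -IH [parity_gates _]/=.
rewrite -[[:: _; _; _]]/(rcons (rcons (rcons [::] _) _) _) -!rcons_cat cats0.
set gs := parity_gates n.
rewrite !eval_gates_rcons /=.
set vals := eval_gates x y gs.
have szv : size vals = 3 * n by rewrite size_eval_gates size_parity_gates.
have ext b : eval_wire x y (rcons vals b) (parity_out n) = eval_wire x y vals (parity_out n).
  case: (n) szv => //= n' szv; rewrite nth_rcons szv ifT //; lia.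
rewrite ext; set z := eval_wire x y vals (parity_out n).
rewrite !nth_rcons !size_rcons szv !ltnn !eqxx.
have -> : 3 * n + 2 = (3 * n).+2 by lia.
rewrite !ltnn !eqxx !ltnS leqnn.
by case: z; case: (x n.+1).
Qed.

Theorem theorem2 (n : nat) (hn : 1 <= n) :
  size_ndc_eq n (parity n) (3 * (n - 1)).
Proof.
split; last first.
  move=> s [m [C [okC [<- comp]]]].
  have := realizable_size_ge _ (parity_on_parity n) (circuit_realizable okC comp).
  rewrite size_map size_iota; apply.
  by rewrite map_inj_uniq ?iota_uniq // => i j [].
case: n hn => // n _; rewrite subn1 /=.
(* A deterministic circuit attains the bound, so there are no guesses and any function can stand for
   [y]. *)
exists 0, (Circuit (parity_gates n) (parity_out n)); split; last split.
- split; first by move=> k; rewrite /= size_parity_gates; apply: parity_gates_ok.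
  by rewrite /= size_parity_gates; case: n => //= n; lia.
- exact: size_parity_gates.
- move=> x; split=> [px|[y]]; last by rewrite /eval_circuit parity_gates_eval.
  by exists x; rewrite /eval_circuit parity_gates_eval.
Qed.
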